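(* If $\mathcal{B}$ is a quasi-greedy basis in a quasi-Banach space $\mathbb{X}$, then $\mathcal{B}$ is lower unconditional for constant coefficients (LUCC). Quantitatively, if $\mathbb{X}$ is a $p$-Banach space ($0<p\le1$), then $$K_{lc}\le C_{qg}\,\eta_p(C_{qg}),$$ where for $u>0$, $$\eta_p(u)=\min_{0<t<1}(1-t^p)^{-1/p}\left(1-(1+A_p^{-1}u^{-1}t)^{-p}\right)^{-1/p},\qquad A_p=(2^p-1)^{-1/p}.$$
   Context: The scalar field is $\mathbb{R}$ or $\mathbb{C}$. A quasi-norm satisfies the axioms of a norm except that the triangle inequality is replaced by $\Vert f+g\Vert\le\kappa(\Vert f\Vert+\Vert g\Vert)$ for some constant $\kappa\ge1$; a quasi-Banach space is a vector space complete for the topology of a quasi-norm. It is a $p$-Banach space if moreover $\Vert f+g\Vert^p\le\Vert f\Vert^p+\Vert g\Vert^p$ for all $f,g$. A basis of $\mathbb{X}$ is a sequence $\mathcal{B}=(\mathbf{x}_n)_{n=1}^\infty$ whose closed linear span is $\mathbb{X}$ and for which there is a (unique) sequence $(\mathbf{x}_n^* )_{n=1}^\infty$ in $\mathbb{X}^*$ with $\mathbf{x}_n^*(\mathbf{x}_k)=\delta_{k,n}$. It is $M$-bounded if $\sup_n\Vert\mathbf{x}_n\Vert\,\Vert\mathbf{x}_n^*\Vert<\infty$ and semi-normalized if $0<\inf_n\Vert\mathbf{x}_n\Vert\le\sup_n\Vert\mathbf{x}_n\Vert<\infty$. For finite $A\subseteq\mathbb{N}$, $S_A(f)=\sum_{n\in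 A}\mathbf{x}_n^*(f)\mathbf{x}_n$. A set $A\subseteq\mathbb{N}$ is a greedy set of $f$ if $|\mathbf{x}_k^*(f)|\le|\mathbf{x}_n^*(f)|$ for all $n\in A$, $k\in\mathbb{N}\setminus A$. A quasi-greedy basis is an $M$-bounded semi-normalized basis for which there is $C<\infty$ with $\Vert S_A(f)\Vert\le C\Vert f\Vert$ for all $f$ and all finite greedy sets $A$ of $f$. In that case $C_{qg}$ denotes the smallest constant $C$ such that $\Vert S_{A\setminus B}(f)\Vert\le C\Vert f\Vert$ for all $f\in\mathbb{X}$ and all finite greedy sets $B\subseteq A$ of $f$. $\mathcal{B}$ is LUCC if there is $C\ge 1$ such that for all finite $A\subseteq\mathbb{N}$, all scalars $(\varepsilon_n)_{n\in A}$ of modulus one, and all real numbers $a_n\ge1$ ($n\in A$), $\left\Vert\sum_{n\in A}\varepsilon_n\mathbf{x}_n\right\Vert\le C\left\Vert\sum_{n\in A}\varepsilon_na_n\mathbf{x}_n\right\Vert$; the smallest such $C$ is $K_{lc}$. *)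

(* Defs.v *)
From HB Require Import structures.
From mathcomp Require Import all_boot all_order all_algebra.
From mathcomp Require Import finmap.
From mathcomp Require Import boolp classical_sets reals ereal exp.
From mathcomp Require Import complex.

Set Implicit Arguments.
Unset Strict Implicit.
Unset Printing Implicit Defensive.

Import Order.TTheory GRing.Theory Num.Theory.

Local Open Scope classical_set_scope.
Local Open Scope ring_scope.

Variant scalar_kind := RealScalars | ComplexScalars.

Definition scalar_field (R : realType) (k : scalar_kind) : numFieldType :=
  match k with RealScalars => R | ComplexScalars => R[i] end.

Definition of_real (R : realType) (k : scalar_kind) : R -> scalar_field R k :=
  match k with
  | RealScalars => fun a => a
  | ComplexScalars => fun a => a%:C%C
  end.

(* In MathComp the norm of a complex number is itself a complex number;
   [modulus] takes its values in the reals for both scalar fields. *)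
Definition modulus (R : realType) (k : scalar_kind) : scalar_field R k -> R :=
  match k with
  | RealScalars => fun a => `|a|
  | ComplexScalars => fun z => ComplexField.Normc.normc z
  end.

Definition is_minimum (R : realType) (S : set R) (m : R) : Prop :=
  S m /\ lbound S m.

Section QuasiNormedSpaces.
Context (R : realType) (k : scalar_kind) (X : lmodType (scalar_field R k)).
Implicit Types (N : X -> R) (x : nat -> X) (xs : nat -> {scalar X}).
Implicit Types (f g : X) (A B : {fset nat}).

Record is_quasi_norm N : Prop := {
  qnorm_ge0 : forall f, 0 <= N f;
  qnorm_eq0 : forall f, N f = 0 -> f = 0;
  qnormZ : forall (a : scalar_field R k) f, N (a *: f) = modulus a * N f;
  qnormD : exists2 kappa : R, 1 <= kappa &
    forall f g, N (f + g) <= kappa * (N f + N g) }.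

(* The vector topology of a quasi-norm has the sets [N < eps] as a countable
   base of neighbourhoods of 0 (up to restricting eps to 1/n), so completeness,
   closures and continuity can be expressed with sequences and eps/delta. *)
Definition is_complete N : Prop :=
  forall u : nat -> X,
    (forall eps : R, 0 < eps -> exists n0 : nat, forall m n : nat,
       (n0 <= m)%N -> (n0 <= n)%N -> N (u m - u n) < eps) ->
    exists l : X, forall eps : R, 0 < eps -> exists n0 : nat, forall n : nat,
      (n0 <= n)%N -> N (u n - l) < eps.

Definition quasi_banach N : Prop := is_quasi_norm N /\ is_complete N.

Definition p_banach (p : R) N : Prop :=
  quasi_banach N /\ forall f g, N (f + g) `^ p <= N f `^ p + N g `^ p.

Definition is_continuous N (phi : {scalar X}) : Prop :=
  forall f (eps : R), 0 < eps -> exists2 delta : R, 0 < delta &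
    forall g, N (g - f) < delta -> modulus (phi g - phi f) < eps.

Definition dual_norm N (phi : {scalar X}) : \bar R :=
  ereal_sup [set (modulus (phi f))%:E | f in [set f | N f <= 1]].

Record is_basis N x xs : Prop := {
  basis_total : forall f (eps : R), 0 < eps ->
    exists (A : {fset nat}) (c : nat -> scalar_field R k),
      N (f - \sum_(n <- A) c n *: x n) < eps;
  basis_coord_continuous : forall n, is_continuous N (xs n);
  basis_biorthogonal : forall n j, xs n (x j) = (j == n)%:R }.

Definition M_bounded N x xs : Prop :=
  exists M : R, forall n, ((N (x n))%:E * dual_norm N (xs n) <= M%:E)%E.

Definition semi_normalized N x : Prop :=
  (exists2 c : R, 0 < c & forall n, c <= N (x n)) /\
  (exists C : R, forall n, N (x n) <= C).

Definition coord_proj x xs A f : X := \sum_(n <- A) xs n f *: x n.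

Definition is_greedy_set xs f A : Prop :=
  forall n j, n \in A -> j \notin A -> modulus (xs j f) <= modulus (xs n f).

Definition quasi_greedy N x xs : Prop :=
  [/\ is_basis N x xs, M_bounded N x xs, semi_normalized N x &
    exists C : R, forall f A, is_greedy_set xs f A ->
      N (coord_proj x xs A f) <= C * N f].

Definition qg_constants N x xs : set R :=
  [set C : R | forall f A B, is_greedy_set xs f A -> is_greedy_set xs f B ->
    (B `<=` A)%fset -> N (coord_proj x xs (A `\` B)%fset f) <= C * N f].

Definition lucc_constants N x : set R :=
  [set C : R | 1 <= C /\
    forall A (e : nat -> scalar_field R k) (a : nat -> R),
      (forall n, n \in A -> modulus (e n) = 1) ->
      (forall n, n \in A -> 1 <= a n) ->
      N (\sum_(n <- A) e n *: x n) <=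
        C * N (\sum_(n <- A) (e n * of_real k (a n)) *: x n)].

Definition lucc N x : Prop := exists C : R, lucc_constants N x C.

Definition is_Cqg N x xs (C : R) : Prop := is_minimum (qg_constants N x xs) C.

Definition is_Klc N x (K : R) : Prop := is_minimum (lucc_constants N x) K.

End QuasiNormedSpaces.

Definition A_const (R : realType) (p : R) : R := (2 `^ p - 1) `^ (- p^-1).

Definition is_eta (R : realType) (p u m : R) : Prop :=
  is_minimum
    [set (1 - t `^ p) `^ (- p^-1) *
         (1 - (1 + (A_const p)^-1 * u^-1 * t) `^ (- p)) `^ (- p^-1)
     | t in [set t : R | 0 < t < 1]] m.

(* Main.v *)
(* Let f = sum_A e_n a_n x_n with all a_n >= 1, and cut A into the levels
   A_j = { n | mu^j <= a_n < mu^(j+1) }, differences of nested greedy sets of f.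
   On one level, mu^-j f restricted to A_j is a perturbation of
   1_j = sum_(A_j) e_n x_n with coefficients in [0, mu - 1].  Expanding these
   coefficients in base 2 bounds the perturbation by a multiple of
   (mu - 1) sup_(B subset A_j) |sum_B e_n x_n|, and each such B is a greedy set
   of 1_j; so for mu close to 1 the perturbation is absorbed and
   |1_j| <= K mu^-j |f|.  The levels are then summed as a geometric series.

   With V = N^p this gives the quantitative bound, for mu = 1 + t / (A_p C).
   With V = N and a modulus of concavity kap, a geometric series needs ratio
   < 1 / kap, so s consecutive levels with kap < mu^s are first merged into
   one; this proves the qualitative part without renorming the space. *)

Require Import Defs.
From HB Require Import structures.
From mathcomp Require Import all_boot all_order all_algebra.
From mathcomp Require Import finmap.
From mathcomp Require Import boolp classical_sets set_interval reals ereal exp.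
From mathcomp Require Import topology normedtype derive.
From mathcomp Require Import complex.
From mathcomp Require Import ring lra.

Set Implicit Arguments.
Unset Strict Implicit.
Unset Printing Implicit Defensive.

Import Order.TTheory GRing.Theory Num.Theory.
Import numFieldNormedType.Exports.

Local Open Scope ring_scope.

(** * Suprema, real powers and geometric growth *)

(** The bound [b] makes [sup S] finite, so [sup S <= al + be * sup S] can be solved for [sup S]. *)
Lemma ubound_affine_fixpoint (R : realType) (S : set R) (b al be : R) :
  be < 1 -> ubound S b ->
  (forall T, ubound S T -> ubound S (al + be * T)) -> ubound S (al / (1 - be)).
Proof.
move=> be1 Sb Saff s Ss.
have hS : has_ubound S by exists b.
have hn : classical_sets.nonempty S by exists s.
have h : sup S <= al + be * sup S.
  by apply: ge_sup => //; apply: Saff; exact: ub_le_sup.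
apply: (le_trans (ub_le_sup hS Ss)).
rewrite ler_pdivlMr ?subr_gt0 //; lra.
Qed.

Lemma powR_le1 (R : realType) (a q : R) : 0 <= q -> 0 <= a <= 1 -> a `^ q <= 1.
Proof.
move=> q0 /andP[a0 a1]; have <- : 1 `^ q = 1 :> R by rewrite powR1.
by apply: ge0_ler_powR; rewrite ?nnegrE.
Qed.

Lemma powR_exprn (R : realType) (a q : R) n :
  0 <= a -> (a ^+ n) `^ q = (a `^ q) ^+ n.
Proof.
move=> a0; elim: n => [|n IH]; first by rewrite !expr0 powR1.
by rewrite !exprS powRM ?exprn_ge0 // IH.
Qed.

Lemma powR_lt1 (R : realType) (a q : R) : 0 < q -> 0 <= a < 1 -> a `^ q < 1.
Proof.
move=> q0 /andP[a0 a1]; have <- : 1 `^ q = 1 :> R by rewrite powR1.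
by apply: gt0_ltr_powR; rewrite ?nnegrE.
Qed.

Lemma two_powR_gt1 (R : realType) (q : R) : 0 < q -> 1 < 2 `^ q :> R.
Proof.
move=> q0; have := @gt0_ltr_powR R q q0 1 2.
by rewrite !nnegrE powR1 => -> //; rewrite ltr1n.
Qed.

Lemma powRV (R : realType) (a q : R) : 0 <= a -> a^-1 `^ q = (a `^ q)^-1.
Proof. by move=> a0; rewrite -[a^-1]powR_inv1 // powRAC powR_inv1 ?powR_ge0. Qed.

Lemma A_const_powR (R : realType) (p : R) : 0 < p -> A_const p `^ p = (2 `^ p - 1)^-1.
Proof.
move=> p0; rewrite -powRrM mulNr mulVf ?gt_eqF // powR_inv1 //.
by rewrite subr_ge0 ltW // two_powR_gt1.
Qed.

(** Bernoulli's inequality and the Archimedean property. *)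
Lemma exprn_unbounded (R : realType) (mu b : R) : 1 < mu -> exists m, b < mu ^+ m.
Proof.
move=> mu1; have m0 : 0 < mu - 1 by rewrite subr_gt0.
have bern n : n%:R * (mu - 1) <= mu ^+ n.
  apply: (@le_trans _ _ (1 + n%:R * (mu - 1))); first by rewrite lerDr ler01.
  elim: n => [|n IH]; first by rewrite mul0r addr0 expr0.
  have n0 : 0 <= n%:R :> R by rewrite ler0n.
  rewrite exprS -natr1; apply: (@le_trans _ _ (mu * (1 + n%:R * (mu - 1)))).
    have : 0 <= n%:R * (mu - 1) * (mu - 1) by rewrite !mulr_ge0 // ltW.
    lra.
  by apply: ler_wpM2l => //; rewrite (le_trans ler01) // ltW.
exists (Num.bound (`|b| / (mu - 1))); apply: lt_le_trans (bern _).
rewrite -ltr_pdivrMr //; apply: le_lt_trans (archi_boundP _).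
  by rewrite ler_pM2r ?invr_gt0 // ler_norm.
by rewrite divr_ge0 // ltW.
Qed.

(* Covers both a quasi-norm ([q = 1]) and the [p]-th power of a [p]-norm
   ([q = p], [kap = 1]). *)
Record homogeneous_quasi_additive (R : realType) (F : nzRingType)
    (rho : {rmorphism R -> F}) (X : lmodType F) (q kap : R) (V : X -> R) : Prop := {
  hqa_ge0 : forall f, 0 <= V f;
  hqaN : forall f, V (- f) = V f;
  hqaD : forall f g, V (f + g) <= kap * (V f + V g);
  hqaZ : forall c f, 0 <= c -> V (rho c *: f) = c `^ q * V f }.

(** * Estimates for finite sums cut into levels *)

Section LevelSums.
Context (R : realType) (F : nzRingType) (rho : {rmorphism R -> F}).
Context (X : lmodType F) (q kap : R) (V : X -> R).
Context (q_gt0 : 0 < q) (kap_ge1 : 1 <= kap).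
Context (hV : homogeneous_quasi_additive rho q kap V).

Let kap_gt0 : 0 < kap. Proof. exact: lt_le_trans kap_ge1. Qed.
Let V_ge0 := hqa_ge0 hV.
Let VD := hqaD hV.
Let VZ := hqaZ hV.

Lemma hqa0 : V 0 = 0.
Proof. by rewrite -(scaler0 _ (rho 0)) VZ // powR0 ?mul0r ?gt_eqF. Qed.

Section Sums.
Context (r : seq nat) (y : nat -> X).
Implicit Types (P Q : pred nat) (a : nat -> R).

Definition rsum P a : X := \sum_(n <- r | P n) rho (a n) *: y n.

Definition usum P : X := \sum_(n <- r | P n) y n.

Lemma rsumZ P a (c : R) : rsum P (fun n => c * a n) = rho c *: rsum P a.
Proof. by rewrite scaler_sumr; apply: eq_bigr => n _; rewrite rmorphM scalerA. Qed.

Lemma usum_split P Q :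
  usum P = usum (fun n => P n && Q n) + usum (fun n => P n && ~~ Q n).
Proof. exact: bigID. Qed.

Lemma eq_rsum P Q a : P =1 Q -> rsum P a = rsum Q a.
Proof. by move=> h; exact: eq_bigl. Qed.

Lemma eq_usum P Q : P =1 Q -> usum P = usum Q.
Proof. by move=> h; exact: eq_bigl. Qed.

(** A crude bound, depending on [r] and [P], which makes the supremum in [rsum_le_usum] finite. *)
Lemma rsum_bounded P : exists b, forall a,
  (forall n, P n -> 0 <= a n <= 1) -> V (rsum P a) <= b.
Proof.
rewrite /rsum; elim: r => [|n s [b hb]].
  by exists 0 => a _; rewrite big_nil hqa0.
exists (b + kap * (V (y n) + b)) => a ha.
have b0 : 0 <= b.
  by apply: (le_trans (V_ge0 _)); apply: (hb (fun=> 0)) => *; rewrite lexx ler01.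
have h1 : 0 <= kap * (V (y n) + b) by rewrite mulr_ge0 ?addr_ge0 // ltW.
rewrite big_cons; case: ifP => Pn; last by have := hb _ ha; lra.
apply: (le_trans (VD _ _)).
apply: (@le_trans _ _ (kap * (V (y n) + b))); last by lra.
apply: ler_wpM2l; first exact: ltW.
apply: lerD; last exact: hb.
have /andP[a0 a1] := ha _ Pn.
rewrite VZ //; apply: ler_piMl => //.
by apply: powR_le1; rewrite ?a0 // ltW.
Qed.

(** Each binary digit costs one quasi-triangle inequality and one halving. For [kap = 1] this is the
    sum of [2 ^ (- i q)] over [1 <= i <= s]. *)
Definition dyadic_const (s : nat) : R :=
  iter s (fun d => 2^-1 `^ q * (kap * (1 + d))) 0.

(* The first [s] binary digits of the coefficients, rounding with [<=] so that
   the remainders stay in [[0, 1]]. *)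
Lemma dyadic_expansion P M s a :
  (forall Q, V (usum (fun n => P n && Q n)) <= M) ->
  (forall n, P n -> 0 <= a n <= 1) ->
  exists2 a' : nat -> R, forall n, P n -> 0 <= a' n <= 1 &
    V (rsum P a - rho (2^-1 ^+ s) *: rsum P a') <= dyadic_const s * M.
Proof.
move=> hM; elim: s a => [|s IH] a ha.
  by exists a => //; rewrite expr0 rmorph1 scale1r subrr hqa0 mul0r.
pose Q n := 2^-1 <= a n.
pose a1 n := 2 * a n - (Q n)%:R.
have ha1 n : P n -> 0 <= a1 n <= 1.
  move=> /ha /andP[h0 h1]; rewrite /a1 /Q.
  by case: (lerP 2^-1 (a n)) => h; rewrite ?mulr1n ?mulr0n; lra.
have [a' ha' hle] := IH _ ha1.
exists a' => //.
have -> : rsum P a = rho 2^-1 *: (usum (fun n => P n && Q n) + rsum P a1).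
  rewrite /usum big_mkcondr -big_split scaler_sumr; apply: eq_bigr => n _ /=.
  rewrite /a1; case: ifP => h; rewrite ?mulr1n ?mulr0n ?subr0 ?add0r.
    rewrite -[in X in X + _](scale1r (y n)) -(rmorph1 rho) -scalerDl -rmorphD.
    by rewrite scalerA -rmorphM; congr (rho _ *: _); field.
  by rewrite scalerA -rmorphM; congr (rho _ *: _); field.
rewrite exprS rmorphM -scalerA -scalerBr -addrA VZ ?invr_ge0 ?ler0n //.
rewrite /dyadic_const iterS -mulrA; apply: ler_wpM2l; first exact: powR_ge0.
apply: (le_trans (VD _ _)); rewrite -mulrA mulrDl mul1r.
by apply: ler_wpM2l; [exact: ltW | exact: lerD].
Qed.

Definition convexity_const (s : nat) : R :=
  kap * dyadic_const s / (1 - kap * (2^-1 ^+ s) `^ q).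

(** After [s] digits the remainder is [2^-1 ^+ s] times a sum of the same kind. Hence the supremum
    over all coefficients in [0, 1] is bounded by an affine function of itself, of slope less than
    1. *)
Lemma rsum_le_usum P M s a :
  kap * (2^-1 ^+ s) `^ q < 1 ->
  (forall Q, V (usum (fun n => P n && Q n)) <= M) ->
  (forall n, P n -> 0 <= a n <= 1) ->
  V (rsum P a) <= convexity_const s * M.
Proof.
move=> hs hM ha; rewrite /convexity_const mulrAC.
pose S : set R := [set V (rsum P b) | b in [set b | forall n, P n -> 0 <= b n <= 1]]%classic.
have [b hb] := rsum_bounded P.
apply: (@ubound_affine_fixpoint R S b) => //.
- by move=> _ [c hc <-]; exact: hb.
- move=> T hT _ [c hc <-].
  have [c' hc' hle] := dyadic_expansion s hM hc.
  rewrite -[rsum P c](subrK (rho (2^-1 ^+ s) *: rsum P c')).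
  apply: (le_trans (VD _ _)); rewrite -!mulrA -mulrDr.
  apply: ler_wpM2l; first exact: ltW.
  apply: lerD => //; rewrite VZ ?exprn_ge0 ?invr_ge0 ?ler0n //.
  by apply: ler_wpM2l; [exact: powR_ge0 | apply: hT; exists c'].
- by exists a.
Qed.

(* For a quasi-greedy basis, cutting [rsum P a] between
   two heights gives the difference of two nested greedy projections, and any
   partial sum of [usum P] is a greedy projection. *)
Record greedy_stable (D : R) : Prop := {
  greedy_slice : forall P a s t, (forall n, P n -> 0 <= a n) ->
    V (rsum (fun n => P n && (s <= a n < t)) a) <= D * V (rsum P a);
  greedy_sub : forall P Q, V (usum (fun n => P n && Q n)) <= D * V (usum P) }.

Definition level_estimate (mu K : R) : Prop :=
  forall P a, (forall n, P n -> 1 <= a n < mu) ->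
    V (usum P) <= K * V (rsum P a).

Lemma narrow_level_estimate D s mu :
  greedy_stable D -> 1 < mu ->
  kap * (2^-1 ^+ s) `^ q < 1 ->
  kap * ((mu - 1) `^ q * (convexity_const s * D)) < 1 ->
  level_estimate mu (kap / (1 - kap * ((mu - 1) `^ q * (convexity_const s * D)))).
Proof.
move=> hD mu1 hs; set be := kap * _ => hbe P a ha.
(* The excess of [a] over 1 is rescaled from [0, mu - 1] to [0, 1], the range required by
   [rsum_le_usum]. *)
pose b n := (mu - 1)^-1 * (a n - 1).
have m0 : 0 < mu - 1 by rewrite subr_gt0.
have hb n : P n -> 0 <= b n <= 1.
  move=> /ha /andP[h1 h2]; apply/andP; split.
    by rewrite /b mulr_ge0 ?invr_ge0 ?subr_ge0 // ltW.
  by rewrite /b mulrC ler_pdivrMr // mul1r lerB // ltW.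
have eqU : usum P = rsum P a - rho (mu - 1) *: rsum P b.
  rewrite -rsumZ -sumrB; apply: eq_bigr => n _.
  rewrite -scalerBl -rmorphB -[LHS]scale1r -(rmorph1 rho).
  by congr (rho _ *: _); rewrite /b; field; rewrite gt_eqF.
(* By [greedy_sub] every partial sum is at most [D * V (usum P)], so the perturbation is bounded by
   a multiple of [V (usum P)] itself, and [be < 1] absorbs it. *)
have hU : V (usum P) <= kap * V (rsum P a) + be * V (usum P).
  rewrite [in leLHS]eqU; apply: (le_trans (VD _ _)).
  rewrite (hqaN hV) VZ ?(ltW m0) // mulrDr lerD2l /be.
  rewrite -[leRHS]mulrA -[in leRHS](mulrA (_ `^ _)).
  apply: ler_wpM2l; first exact: ltW.
  apply: ler_wpM2l; first exact: powR_ge0.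
  rewrite -mulrA; apply: rsum_le_usum => // Q; exact: greedy_sub.
rewrite mulrAC ler_pdivlMr ?subr_gt0 //; lra.
Qed.

Lemma level_estimate_scale mu K P a (s : R) :
  level_estimate mu K -> 0 < s -> (forall n, P n -> s <= a n < s * mu) ->
  V (usum P) <= K * (s^-1 `^ q * V (rsum P a)).
Proof.
move=> hK s0 ha; rewrite -VZ ?invr_ge0 ?(ltW s0) // -rsumZ.
apply: hK => n /ha /andP[h1 h2].
by rewrite ler_pdivlMl // mulr1 h1 ltr_pdivrMl.
Qed.

(** Merging one more level costs a factor [kap], and each of the two pieces is cut out of the sum at
    price [D]. *)
Definition iter_level_const (D K : R) (s : nat) : R :=
  iter s (fun K' => kap * (K' * D + K * D)) 0.

Lemma iter_level_const_ge0 D K s : 0 <= D -> 0 <= K -> 0 <= iter_level_const D K s.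
Proof.
by move=> D0 K0; elim: s => //= s IH; rewrite mulr_ge0 ?addr_ge0 ?mulr_ge0 // ltW.
Qed.

(** Induction on [s] peels off the top level [mu ^+ s <= a n < mu ^+ s.+1], which rescales to [1,
    mu). *)
Lemma iter_level_estimate D mu K s :
  greedy_stable D -> 0 <= D -> 0 <= K -> 1 < mu -> level_estimate mu K ->
  level_estimate (mu ^+ s) (iter_level_const D K s).
Proof.
move=> hD D0 K0 mu1 hK; elim: s => [|s IH] P a ha.
  (* For [s = 0] the window [1 <= a n < 1] is empty. *)
  rewrite mul0r /usum big1 ?hqa0 // => n /ha.
  by rewrite expr0; case: leP => //= h /(le_lt_trans h); rewrite ltxx.
have a0 n : P n -> 0 <= a n by move=> /ha /andP[h _]; exact: le_trans h.
have mus1 : 1 <= mu ^+ s by rewrite exprn_ege1 // ltW.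
have mus0 : 0 < mu ^+ s by exact: lt_le_trans mus1.
rewrite (usum_split P (fun n => 1 <= a n < mu ^+ s)).
apply: (le_trans (VD _ _)); rewrite /iter_level_const iterS -mulrA.
apply: ler_wpM2l; first exact: ltW.
rewrite mulrDl -!mulrA; apply: lerD.
  apply: (@le_trans _ _ (iter_level_const D K s *
      V (rsum (fun n => P n && (1 <= a n < mu ^+ s)) a))).
    by apply: IH => n /andP[].
  apply: ler_wpM2l; last exact: greedy_slice.
  exact: iter_level_const_ge0.
have e : (fun n => P n && ~~ (1 <= a n < mu ^+ s)) =1
         (fun n => P n && (mu ^+ s <= a n < mu ^+ s.+1)).
  move=> n; case Pn: (P n) => //=; have /andP[-> ->] := ha _ Pn.
  by rewrite andbT /= -leNgt.
rewrite (eq_usum e).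
apply: (le_trans (level_estimate_scale (a := a) hK mus0 _)).
  by move=> n /andP[_]; rewrite exprSr.
apply: ler_wpM2l => //; apply: le_trans (greedy_slice hD (mu ^+ s) (mu ^+ s.+1) a0).
(* The rescaling factor is only bounded by 1: a finite constant is wanted here, not decay. *)
apply: ler_piMl => //; apply: powR_le1; first exact: ltW.
by rewrite invr_ge0 (ltW mus0) invf_le1.
Qed.

(** The level at height [mu ^+ j] is a slice of the sum, so it costs
    [K * w ^+ j * D * V (rsum P a)]. Since [kap * w < 1], these costs stay summable under repeated
    quasi-triangle inequalities. *)
Lemma usum_le_rsum D mu K P a :
  greedy_stable D -> 0 <= K -> 0 <= D -> 1 < mu -> level_estimate mu K ->
  kap * mu^-1 `^ q < 1 ->
  (forall n, P n -> 1 <= a n) ->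
  V (usum P) <= kap * K / (1 - kap * mu^-1 `^ q) * (D * V (rsum P a)).
Proof.
move=> hD K0 D0 mu1 hK; set w := mu^-1 `^ q => hmu ha; set G := D * _; set Q := _ / _.
have mu0 : 0 < mu by exact: lt_trans mu1.
have a0 n : P n -> 0 <= a n by move=> /ha; exact: le_trans.
have G0 : 0 <= G by rewrite mulr_ge0.
have Q0 : 0 <= Q by rewrite divr_ge0 ?subr_ge0 ?mulr_ge0 // ltW.
(* [Q] is the sum of the geometric series of terms [kap * K * (kap * w) ^+ i], so it reproduces
   itself when one level is added. *)
have QE : kap * (K + w * Q) = Q.
  by rewrite /Q; field; rewrite subr_eq0 eq_sym lt_eqF.
(* Induction on the number [m] of levels with the starting level [j] free: the lowest level is split
   off and the rest starts at [j.+1]. *)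
have main m j : V (usum (fun n => P n && (mu ^+ j <= a n < mu ^+ (j + m)))) <=
    w ^+ j * (Q * G).
  elim: m j => [|m IH] j.
    rewrite /usum big1 ?hqa0 => [|n /andP[_]].
      by apply: mulr_ge0; [rewrite exprn_ge0 ?powR_ge0 | exact: mulr_ge0].
    by rewrite addn0; case: leP => //= h /(le_lt_trans h); rewrite ltxx.
  rewrite (usum_split _ (fun n => a n < mu ^+ j.+1)).
  have muj : 0 < mu ^+ j by rewrite exprn_gt0.
  have mujS : mu ^+ j <= mu ^+ j.+1 by rewrite ler_eXn2l.
  have mujm : mu ^+ j.+1 <= mu ^+ (j + m.+1) by rewrite addnS -addSn ler_eXn2l ?leq_addr.
  have -> : usum (fun n => P n && (mu ^+ j <= a n < mu ^+ (j + m.+1)) && (a n < mu ^+ j.+1)) =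
      usum (fun n => P n && (mu ^+ j <= a n < mu ^+ j.+1)).
    apply: eq_usum => n; rewrite -andbA; congr (_ && _); rewrite -andbA; congr (_ && _).
    by apply: andb_idl => /lt_le_trans; exact.
  have -> : usum (fun n => P n && (mu ^+ j <= a n < mu ^+ (j + m.+1)) && ~~ (a n < mu ^+ j.+1)) =
      usum (fun n => P n && (mu ^+ j.+1 <= a n < mu ^+ (j.+1 + m))).
    apply: eq_usum => n; rewrite -andbA -leNgt addSnnS; congr (_ && _).
    rewrite andbC andbA; congr (_ && _); apply: andb_idr; exact: le_trans.
  apply: (le_trans (VD _ _)).
  apply: (@le_trans _ _ (kap * (w ^+ j * (K * G) + w ^+ j.+1 * (Q * G)))).
    apply: ler_wpM2l; first exact: ltW.
    apply: lerD; last exact: IH.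
    apply: (le_trans (level_estimate_scale (a := a) hK muj _)).
      by move=> n /andP[_]; rewrite exprSr.
    have -> : (mu ^+ j)^-1 `^ q = w ^+ j.
      by rewrite -(exprVn mu j) powR_exprn // invr_ge0 ltW.
    rewrite mulrCA; apply: ler_wpM2l; first by rewrite exprn_ge0 ?powR_ge0.
    by apply: ler_wpM2l => //; exact: greedy_slice.
  by rewrite -[X in _ <= _ * (X * _)]QE exprS le_eqVlt; apply/orP; left; apply/eqP; ring.
(* The sum of all [|a n|] over the finite list [r] dominates each coefficient, so finitely many
   levels suffice. *)
have [m hm] : exists m, forall n, n \in r -> a n < mu ^+ m.
  have [m hm] := exprn_unbounded (\sum_(n <- r) `|a n|) mu1.
  exists m => n nr; apply: le_lt_trans hm.
  rewrite (big_rem n nr) /=; apply: (le_trans (ler_norm _)).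
  by rewrite lerDl sumr_ge0.
have := main m 0; rewrite expr0 mul1r; apply: le_trans.
(* The bound [mu ^+ m] is known only for indices in [r], so membership is added to both sums; the
   level condition then follows from [P n]. *)
rewrite /usum [in leLHS]big_seq_cond [in leRHS]big_seq_cond le_eqVlt; apply/orP; left.
apply/eqP; congr (V _); apply: eq_bigl => n; case nr: (n \in r) => //=.
by case Pn: (P n); rewrite // ha // hm.
Qed.
End Sums.
End LevelSums.

(** * The embedding of the reals into the scalars, and the modulus *)

Lemma of_real_is_zmod_morphism (R : realType) (k : scalar_kind) :
  zmod_morphism (@of_real R k).
Proof. by case: k => //= a b; rewrite rmorphB. Qed.

Lemma of_real_is_monoid_morphism (R : realType) (k : scalar_kind) :
  monoid_morphism (@of_real R k).
Proof. by case: k; split => //= a b; rewrite rmorphM. Qed.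

HB.instance Definition _ (R : realType) (k : scalar_kind) :=
  GRing.isZmodMorphism.Build R (scalar_field R k) (@of_real R k)
    (@of_real_is_zmod_morphism R k).
HB.instance Definition _ (R : realType) (k : scalar_kind) :=
  GRing.isMonoidMorphism.Build R (scalar_field R k) (@of_real R k)
    (@of_real_is_monoid_morphism R k).

Section Modulus.
Context (R : realType) (k : scalar_kind).

Lemma modulusM (a b : scalar_field R k) : modulus (a * b) = modulus a * modulus b.
Proof. case: k a b => a b /=; [exact: normrM | exact: ComplexField.Normc.normcM]. Qed.

Lemma modulus_of_real (c : R) : modulus (of_real k c) = `|c|.
Proof. by case: k => //=; rewrite expr0n addr0 sqrtr_sqr. Qed.

Lemma modulus_ge0 (a : scalar_field R k) : 0 <= modulus a.
Proof. by case: k a => a /=; [exact: normr_ge0 | case: a => u v; exact: sqrtr_ge0]. Qed.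

Lemma modulus0 : modulus (0 : scalar_field R k) = 0.
Proof. by rewrite -(rmorph0 (of_real k)) modulus_of_real normr0. Qed.

End Modulus.

(** * Quasi-greedy bases and the greedy sets of finite sums *)

Section QuasiGreedy.
Context (R : realType) (k : scalar_kind) (X : lmodType (scalar_field R k)).
Context (N : X -> R) (x : nat -> X) (xs : nat -> {scalar X}).
Context (hN : is_quasi_norm N).
Context (hbi : forall n j, xs n (x j) = (j == n)%:R).

Let rho := @of_real R k.

Lemma quasi_norm0 : N 0 = 0.
Proof. by rewrite -(scale0r (0 : X)) (qnormZ hN) modulus0 mul0r. Qed.

Lemma quasi_normN f : N (- f) = N f.
Proof.
by rewrite -scaleN1r -(rmorphN1 rho) (qnormZ hN) modulus_of_real normrN1 mul1r.
Qed.

Lemma quasi_norm_hqa kap :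
  (forall f g, N (f + g) <= kap * (N f + N g)) ->
  homogeneous_quasi_additive rho 1 kap N.
Proof.
move=> hkap; split=> //; first exact: qnorm_ge0.
  exact: quasi_normN.
by move=> c f c0; rewrite (qnormZ hN) modulus_of_real ger0_norm // powRr1.
Qed.

Lemma p_norm_hqa p :
  0 < p -> (forall f g, N (f + g) `^ p <= N f `^ p + N g `^ p) ->
  homogeneous_quasi_additive rho p 1 (fun f => N f `^ p).
Proof.
move=> p0 hp; split=> [f|f|f g|c f c0].
- exact: powR_ge0.
- by rewrite quasi_normN.
- by rewrite mul1r.
- by rewrite (qnormZ hN) modulus_of_real ger0_norm // powRM // (qnorm_ge0 hN).
Qed.

(** The vector [x 0], with the nested greedy sets {0} and the empty set, is its own projection. *)
Lemma qg_constants_ge1 C : N (x 0%N) != 0 -> qg_constants N x xs C -> 1 <= C.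
Proof.
move=> x0 hC.
have /hC h : is_greedy_set xs (x 0%N) [fset 0%N]%fset.
  move=> n j; rewrite !inE => /eqP -> j0.
  by rewrite !hbi eqxx eq_sym (negPf j0) modulus0 modulus_ge0.
have {h} := h fset0 _ (fsub0set _).
rewrite fsetD0 /coord_proj big_seq_fset1 hbi eqxx scale1r.
have e : is_greedy_set xs (x 0%N) fset0 by move=> n j; rewrite inE.
move=> /(_ e); rewrite -[leLHS]mul1r ler_pM2r //.
by rewrite lt_neqAle eq_sym x0 qnorm_ge0.
Qed.

(** For [B] inside [A] the projection on the difference is the difference of two greedy projections,
    each bounded by [C * N f]. *)
Lemma qg_constants_nonempty :
  (exists C : R, forall f A, is_greedy_set xs f A -> N (coord_proj x xs A f) <= C * N f) ->
  exists C, qg_constants N x xs C.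
Proof.
move=> [C hC]; have [kap k1 hkap] := qnormD hN.
exists (kap * (C + C)) => f A B gA gB sBA.
have -> : coord_proj x xs (A `\` B)%fset f = coord_proj x xs A f - coord_proj x xs B f.
  rewrite /coord_proj [in RHS](big_fsetID _ (mem B)) /=.
  set S := \sum_(i <- [fset x in A | x \in B]%fset) _.
  have -> : S = \sum_(n <- B) xs n f *: x n.
    apply: eq_fbigl => n; rewrite !inE /=; apply/andP/idP => [[]//|nB].
    by split => //; exact: (fsubsetP sBA).
  by rewrite addrAC subrr add0r; apply: eq_fbigl => n; rewrite !inE /= andbC.
apply: (le_trans (hkap _ _)); rewrite -mulrA mulrDl quasi_normN.
by apply: ler_wpM2l; [exact: le_trans k1 | apply: lerD; exact: hC].
Qed.

Section Stability.
Context (A : {fset nat}) (e : nat -> scalar_field R k).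
Context (he : forall n, n \in A -> modulus (e n) = 1).

Implicit Types (P Q : pred nat) (a : nat -> R).

Let y n := e n *: x n.

Lemma coord_rsum P a j :
  xs j (rsum rho A y P a) = if (j \in A) && P j then rho (a j) * e j else 0.
Proof.
rewrite /rsum linear_sum.
have E n : xs j (rho (a n) *: y n) = if n == j then rho (a j) * e j else 0.
  rewrite /y scalerA linearZ /= hbi.
  by case: eqP => [->|_]; rewrite ?mulr1 ?mulr0.
under eq_bigr do rewrite E.
rewrite big_mkcond /=; case: (boolP (j \in A)) => jA /=.
  rewrite (bigD1_seq j) ?fset_uniq //= eqxx big1 ?addr0 // => n /negPf ->.
  by case: ifP.
rewrite big_seq big1 // => n nA; case: ifP => // _.
by case: eqP => // nj; rewrite nj (negPf jA) in nA.
Qed.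

Lemma coord_proj_rsum P Q a :
  coord_proj x xs [fset n in A | P n && Q n]%fset (rsum rho A y P a) =
  rsum rho A y (fun n => P n && Q n) a.
Proof.
rewrite /coord_proj -big_fset_condE /rsum big_seq_cond [RHS]big_seq_cond.
apply: eq_bigr => n /andP[nA /andP[Pn _]].
by rewrite coord_rsum nA Pn /y scalerA.
Qed.

(** Since each [e n] has modulus 1, the coordinates have modulus [a n] on the support and 0
    elsewhere, so greediness only compares the [a n]. *)
Lemma greedy_set_rsum P Q a :
  (forall n, P n -> 0 <= a n) ->
  (forall n j, P n -> Q n -> P j -> ~~ Q j -> a j <= a n) ->
  is_greedy_set xs (rsum rho A y P a) [fset n in A | P n && Q n]%fset.
Proof.
move=> a0 hQ n j; rewrite !inE /= => /and3P[nA Pn Qn] hj.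
rewrite !coord_rsum nA Pn /=; case: ifP => [/andP[jA Pj]|_]; last first.
  by rewrite modulus0 modulus_ge0.
rewrite !modulusM !modulus_of_real !he // !mulr1 !ger0_norm ?a0 //.
by apply: hQ => //; move: hj; rewrite jA Pj.
Qed.

(** [Q0] and [Q1] select nested greedy sets, to whose difference [qg_constants] applies. *)
Lemma qg_rsum C P (Q0 Q1 : pred nat) a : qg_constants N x xs C ->
  (forall n, P n -> 0 <= a n) ->
  (forall n j, P n -> Q0 n -> P j -> ~~ Q0 j -> a j <= a n) ->
  (forall n j, P n -> Q1 n -> P j -> ~~ Q1 j -> a j <= a n) ->
  (forall n, Q0 n -> Q1 n) ->
  N (rsum rho A y (fun n => P n && (Q1 n && ~~ Q0 n)) a) <= C * N (rsum rho A y P a).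
Proof.
move=> hC a0 h0 h1 sQ; rewrite -coord_proj_rsum.
have g0 := greedy_set_rsum a0 h0; have g1 := greedy_set_rsum a0 h1.
have := hC _ _ _ g1 g0.
have -> : ([fset n in A | P n && Q1 n] `\` [fset n in A | P n && Q0 n])%fset =
    [fset n in A | P n && (Q1 n && ~~ Q0 n)]%fset.
  apply/fsetP => n; rewrite !inE /=.
  by case: (n \in A); case: (P n); case: (Q0 n); case: (Q1 n).
apply; apply/fsubsetP => n; rewrite !inE /= => /and3P[-> -> /sQ ->] //.
Qed.

Lemma qg_greedy_stable C :
  qg_constants N x xs C -> greedy_stable rho N A y C.
Proof.
move=> hC; split=> [P a s t a0|P Q].
  (* The negated condition keeps [s <= a n], so that the two greedy sets are nested even when
     [t < s]. *)
  rewrite (@eq_rsum _ _ _ _ _ _ _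
    (fun n => P n && ((s <= a n) && ~~ ((s <= a n) && (t <= a n))))).
    apply: qg_rsum => //.
    - move=> n j Pn /andP[sn tn] Pj; rewrite negb_and -!ltNge.
      by case/orP => /ltW /le_trans; apply.
    - by move=> n j Pn sn Pj; rewrite -ltNge => /ltW /le_trans; apply.
    - by move=> n /andP[].
  by move=> n; rewrite ltNge; case: (P n); case: (s <= a n); case: (t <= a n).
have E B : usum A y B = rsum rho A y B (fun=> 1).
  by apply: eq_bigr => n _; rewrite rmorph1 scale1r.
(* All coefficients equal 1, so every subset is greedy; the smaller greedy set is empty. *)
rewrite !E (@eq_rsum _ _ _ _ _ _ _ (fun n => P n && (Q n && ~~ false))).
  by apply: qg_rsum.
by move=> n; rewrite andbT.
Qed.

End Stability.

Lemma greedy_stable_powR p r y C : 0 <= p -> 0 <= C ->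
  greedy_stable rho N r y C ->
  greedy_stable rho (fun f => N f `^ p) r y (C `^ p).
Proof.
move=> p0 C0 [hs hu]; have N0 := qnorm_ge0 hN.
split=> [P a s t a0|P Q]; rewrite -powRM //; apply: ge0_ler_powR;
  by rewrite ?nnegrE ?mulr_ge0 ?hs ?hu.
Qed.

End QuasiGreedy.

(** * Attainment of the minimum that defines [eta_p] *)

Section Eta.
Local Open Scope classical_set_scope.
Context (R : realType).

Lemma powR_continuous_at (p a : R) : 0 < a -> {for a, continuous (fun t : R => t `^ p)}.
Proof.
move=> a0; apply: differentiable_continuous; apply/derivable1_diffP.
by apply: derivable_powR; rewrite in_itv /= a0.
Qed.

(** With [c = 1 / (A_p u)], the function minimized in [eta_p] is this product to the power
    [- 1 / p]. The product remains continuous at 0 and 1, where that function blows up. *)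
Definition eta_denominator (p c t : R) : R := (1 - t `^ p) * (1 - (1 + c * t) `^ (- p)).

Lemma eta_denominator_continuous (p c : R) : 0 < p -> 0 < c ->
  {within `[0, 1], continuous (eta_denominator p c)}.
Proof.
move=> p0 c0.
have right_factor t : 0 <= t -> {for t, continuous (fun u : R => 1 - (1 + c * u) `^ (- p))}.
  move=> t0; apply: cvgB; first exact: cvg_cst.
  apply: (@continuous_comp _ _ _ (fun u : R => 1 + c * u) (fun u : R => u `^ (- p))).
    by apply: cvgD; [exact: cvg_cst | apply: cvgM; [exact: cvg_cst | exact: cvg_id]].
  by apply: powR_continuous_at; rewrite ltr_pwDl // mulr_ge0 // ltW.
have interior t : 0 < t -> {for t, continuous (eta_denominator p c)}.
  move=> t0; apply: cvgM; last exact/right_factor/ltW.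
  by apply: cvgB; [exact: cvg_cst | exact: powR_continuous_at].
apply/continuous_within_itvP; first exact: ltr01.
split.
- by move=> t; rewrite in_itv /= => /andP[t0 _]; exact: interior.
- apply: cvgM; last exact/cvg_at_right_filter/right_factor.
  apply: cvgB; first exact: cvg_cst.
  by rewrite powR0 ?gt_eqF //; exact: powR_cvg0.
- exact/cvg_at_left_filter/interior.
Qed.

Lemma eta_factors_gt0 (p c t : R) : 0 < p -> 0 < c -> 0 < t < 1 ->
  0 < 1 - t `^ p /\ 0 < 1 - (1 + c * t) `^ (- p).
Proof.
move=> p0 c0 /andP[t0 t1]; rewrite !subr_gt0; split.
  by apply: powR_lt1; rewrite ?(ltW t0).
have h : 1 < 1 + c * t by rewrite ltrDl mulr_gt0.
have h0 : 0 < 1 + c * t by exact: lt_trans h.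
rewrite powRN -powRV ?(ltW h0) //; apply: powR_lt1 => //.
by rewrite invr_ge0 (ltW h0) invf_lt1.
Qed.

(** The denominator vanishes at 0 and 1 and is positive between, so its maximum over [0, 1] is
    reached at an interior point. *)
Lemma eta_exists (p u : R) : 0 < p -> 0 < u -> exists m, is_eta p u m.
Proof.
move=> p0 u0; set c := (A_const p)^-1 * u^-1.
have A0 : 0 < A_const p.
  by apply: powR_gt0; rewrite subr_gt0 two_powR_gt1.
have c0 : 0 < c by rewrite mulr_gt0 ?invr_gt0.
have [s + smax] := EVT_max ler01 (eta_denominator_continuous p0 c0).
rewrite in_itv /= => /andP[s0 s1].
have g0 t : 0 < t < 1 -> 0 < eta_denominator p c t.
  by move=> /(eta_factors_gt0 p0 c0)[? ?]; exact: mulr_gt0.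
have valE t : 0 < t < 1 ->
    (1 - t `^ p) `^ (- p^-1) * (1 - (1 + c * t) `^ (- p)) `^ (- p^-1) =
    (eta_denominator p c t `^ p^-1)^-1.
  by move=> /(eta_factors_gt0 p0 c0)[h1 h2]; rewrite -powRM ?(ltW h1) ?(ltW h2) //; exact: powRN.
have hs : 0 < s < 1.
  have h2 : 0 < (2^-1 : R) < 1 by apply/andP; split; lra.
  have : 0 < eta_denominator p c s.
    apply: (lt_le_trans (g0 _ h2)); apply: smax.
    by case/andP: h2 => h2 h3; rewrite in_itv /= (ltW h2) (ltW h3).
  move=> hgs; rewrite !lt_neqAle s0 s1 !andbT; apply/andP; split; apply/eqP => e.
    move: hgs; rewrite /eta_denominator -e mulr0 addr0.
    by have -> : 1 `^ (- p) = 1 :> R; rewrite ?powR1 // subrr mulr0 ltxx.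
  move: hgs; rewrite /eta_denominator e.
  by have -> : 1 `^ p = 1 :> R; rewrite ?powR1 // subrr mul0r ltxx.
exists (eta_denominator p c s `^ p^-1)^-1; split.
  by exists s => //; exact: valE.
move=> _ [t ht <-]; rewrite /= in ht.
rewrite -/c (valE _ ht) lef_pV2 ?posrE; [|exact/powR_gt0/g0..].
apply: ge0_ler_powR; rewrite ?nnegrE ?invr_ge0 ?(ltW p0) ?(ltW (g0 _ _)) //.
by apply: smax; case/andP: ht => t0 t1; rewrite in_itv /= (ltW t0) (ltW t1).
Qed.

End Eta.

(** * Existence of the optimal constants, and the two bounds *)

(** Every constraint is closed in [C] and passes to the infimum of [S]; one with [t.2 = 0] does not
    involve [C] and is inherited from [C0]. *)
Lemma linear_constraints_minimum (R : realType) (T : set (R * R)) (b C0 : R)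
    (S : set R) :
  (forall C, S C <-> b <= C /\ forall t, T t -> t.1 <= C * t.2) ->
  (forall t, T t -> 0 <= t.2) -> S C0 -> exists m, is_minimum S m.
Proof.
move=> hS T0 SC0.
have lbS : lbound S b by move=> C /hS[].
have hlb : has_lbound S by exists b.
have hn : classical_sets.nonempty S by exists C0.
exists (inf S); split; last by move=> C; exact: ge_inf.
apply/hS; split; first exact: lb_le_inf.
move=> t Tt; have := T0 _ Tt; rewrite le_eqVlt => /orP[/eqP t0|t0].
  by have /hS[_ /(_ _ Tt)] := SC0; rewrite -t0 !mulr0.
rewrite -ler_pdivrMr //; apply: lb_le_inf => // C /hS[_ /(_ _ Tt)].
by rewrite ler_pdivrMr.
Qed.

Section Constants.
Context (R : realType) (k : scalar_kind) (X : lmodType (scalar_field R k)).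
Context (N : X -> R) (x : nat -> X) (xs : nat -> {scalar X}).
Context (hN : is_quasi_norm N) (x0 : N (x 0%N) != 0).
Context (hbi : forall n j, xs n (x j) = (j == n)%:R).

Let rho := @of_real R k.

Lemma Cqg_exists C : qg_constants N x xs C -> exists m, is_Cqg N x xs m.
Proof.
move=> hC.
pose T : set (R * R) := [set t | exists f A B, [/\ is_greedy_set xs f A,
  is_greedy_set xs f B, (B `<=` A)%fset &
  t = (N (coord_proj x xs (A `\` B)%fset f), N f)]]%classic.
apply: (@linear_constraints_minimum R T 1 C) => // [D|_ [f [A [B [_ _ _ ->]]]]].
  split=> [hD|[_ hD] f A B gA gB sBA]; last first.
    by apply: (hD (_, _)); exists f, A, B.
  by split; [exact: qg_constants_ge1 hD | move=> _ [f [A [B [gA gB sBA ->]]]]; exact: hD].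
exact: qnorm_ge0.
Qed.

Lemma Klc_exists C : lucc_constants N x C -> exists m, is_Klc N x m.
Proof.
move=> hC.
pose T : set (R * R) := [set t | exists (A : {fset nat}) (e : nat -> scalar_field R k) (a : nat -> R),
  [/\ (forall n, n \in A -> modulus (e n) = 1),
  (forall n, n \in A -> 1 <= a n) &
  t = (N (\sum_(n <- A) e n *: x n), N (\sum_(n <- A) (e n * of_real k (a n)) *: x n))]]%classic.
apply: (@linear_constraints_minimum R T 1 C) => // [D|_ [A [e [a [_ _ ->]]]]].
  split=> [[D1 hD]|[D1 hD]]; split=> //.
    by move=> _ [A [e [a [he ha ->]]]]; exact: hD.
  by move=> A e a he ha; apply: (hD (_, _)); exists A, e, a.
exact: qnorm_ge0.
Qed.

Lemma lucc_constants_of_rsum C : 1 <= C ->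
  (forall (A : {fset nat}) (e : nat -> scalar_field R k) (P : pred nat) (a : nat -> R),
    (forall n, n \in A -> modulus (e n) = 1) ->
    (forall n, P n -> 1 <= a n) ->
    N (usum A (fun n => e n *: x n) P) <= C * N (rsum rho A (fun n => e n *: x n) P a)) ->
  lucc_constants N x C.
Proof.
move=> C1 h; split=> // A e a he ha; have := h A e (fun n => n \in A) a he ha.
rewrite /usum /rsum -!big_seq.
by under [in leRHS]eq_bigr do rewrite scalerA mulrC.
Qed.

Lemma lucc_of_qg C : qg_constants N x xs C -> lucc N x.
Proof.
move=> hC; have [kap k1 hkap] := qnormD hN.
have C0 : 0 <= C by exact: le_trans ler01 (qg_constants_ge1 hN hbi x0 hC).
have hV := quasi_norm_hqa hN hkap.
have kap0 : 0 < kap by exact: lt_le_trans k1.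
(* The number of digits is chosen with [kap < 2 ^+ s]. *)
have [s hs] : exists s, kap * (2^-1 ^+ s) `^ 1 < 1.
  have [s hs] := exprn_unbounded kap (ltr1n R 2); exists s.
  by rewrite powRr1 ?exprn_ge0 ?invr_ge0 // exprVn ltr_pdivrMr ?mul1r ?exprn_gt0.
(* As [mu - 1 = 1 / (1 + w)], the perturbation factor is at most [w / (1 + w) < 1]. *)
pose w := `|kap * (convexity_const 1 kap s * C)|.
pose mu := 1 + (1 + w)^-1.
have w1 : 0 < 1 + w by rewrite ltr_wpDr ?normr_ge0.
have mu1 : 1 < mu by rewrite ltrDl invr_gt0.
have hbe : kap * ((mu - 1) `^ 1 * (convexity_const 1 kap s * C)) < 1.
  rewrite /mu addrAC subrr add0r powRr1 ?invr_ge0 ?(ltW w1) // mulrCA.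
  rewrite ltr_pdivrMl // mulr1; apply: (le_lt_trans (ler_norm _)); rewrite -/w; lra.
set K := kap / (1 - kap * ((mu - 1) `^ 1 * (convexity_const 1 kap s * C))).
have K0 : 0 <= K by rewrite divr_ge0 ?subr_ge0 // ltW.
have [m hm] := exprn_unbounded kap mu1.
have mum : 1 < mu ^+ m by exact: le_lt_trans hm.
have hkm : kap * (mu ^+ m)^-1 `^ 1 < 1.
  by rewrite powRr1 ?invr_ge0 ?ltr_pdivrMr ?mul1r // ?(ltW (lt_trans ltr01 mum)) // (lt_trans ltr01).
pose L := iter_level_const kap C K m.
have L0 : 0 <= L by exact: iter_level_const_ge0.
pose Q := kap * L / (1 - kap * (mu ^+ m)^-1 `^ 1) * C.
(* A LUCC constant must be at least 1, whence the maximum. *)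
exists (Num.max 1 Q); apply: lucc_constants_of_rsum; first by rewrite le_max lexx.
move=> A e P a he ha.
have hst := qg_greedy_stable hbi he hC.
have hK := narrow_level_estimate ltr01 k1 hV hst mu1 hs hbe.
have hL := iter_level_estimate ltr01 k1 hV (s := m) hst C0 K0 mu1 hK.
apply: (le_trans (usum_le_rsum ltr01 k1 hV hst L0 C0 mum hL hkm ha)).
by rewrite mulrA; apply: ler_wpM2r; [exact: qnorm_ge0 | rewrite le_max lexx orbT].
Qed.

(** The level estimates are applied to [V = N ^ p] with [kap = 1], [D = C ^ p] and a single binary
    digit. They give the factor [C ^ p / ((1 - t ^ p) (1 - mu ^ (- p)))], whose [p]-th root is the
    constant stated. *)
Lemma lucc_constants_of_qg C p t : qg_constants N x xs C ->
  0 < p -> (forall f g, N (f + g) `^ p <= N f `^ p + N g `^ p) ->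
  0 < t < 1 ->
  lucc_constants N x (C * ((1 - t `^ p) `^ (- p^-1) *
    (1 - (1 + (A_const p)^-1 * C^-1 * t) `^ (- p)) `^ (- p^-1))).
Proof.
move=> hC p0 hp ht.
have C1 : 1 <= C by exact: qg_constants_ge1 hC.
have C0 : 0 < C by exact: lt_le_trans C1.
have W0 : 0 < 2 `^ p - 1 :> R by rewrite subr_gt0 two_powR_gt1.
have A0 : 0 < A_const p by exact: powR_gt0.
set c := (A_const p)^-1 * C^-1.
have c0 : 0 < c by rewrite mulr_gt0 ?invr_gt0.
have [f1 f2] := eta_factors_gt0 p0 c0 ht.
have /andP[t0 t1] := ht.
set v1 := (1 - t `^ p) `^ (- p^-1); set mu := 1 + c * t.
set v2 := (1 - mu `^ (- p)) `^ (- p^-1).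
have mu1 : 1 < mu by rewrite ltrDl mulr_gt0.
have mu0 : 0 < mu by exact: lt_trans mu1.
have rootK w : 0 < w -> (w `^ (- p^-1)) `^ p = w^-1.
  by move=> w0; rewrite -powRrM mulNr mulVf ?gt_eqF // powR_inv1 // ltW.
have root_ge1 w : 0 < w <= 1 -> 1 <= w `^ (- p^-1).
  move=> /andP[w0 w1]; rewrite powRN invf_ge1 ?powR_gt0 //.
  by apply: powR_le1; rewrite ?invr_ge0 ?(ltW p0) ?(ltW w0).
have v1_ge1 : 1 <= v1 by apply: root_ge1; rewrite f1 gerBl powR_ge0.
have v2_ge1 : 1 <= v2 by apply: root_ge1; rewrite f2 gerBl powR_ge0.
have v1p : v1 `^ p = (1 - t `^ p)^-1 := rootK _ f1.
have v2p : v2 `^ p = (1 - mu `^ (- p))^-1 := rootK _ f2.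
clearbody v1 v2.
have v1_ge0 : 0 <= v1 := le_trans ler01 v1_ge1.
have v2_ge0 : 0 <= v2 := le_trans ler01 v2_ge1.
apply: lucc_constants_of_rsum => [|A e P a he ha].
  by rewrite mulr_ege1 // mulr_ege1.
have hV := p_norm_hqa hN p0 hp.
have hst := greedy_stable_powR hN (ltW p0) (ltW C0) (qg_greedy_stable hbi he hC).
have half : 2^-1 `^ p = (2 `^ p)^-1 :> R by rewrite powRV.
have hs : 1 * (2^-1 ^+ 1) `^ p < 1 :> R.
  by rewrite mul1r expr1 half invf_lt1 ?two_powR_gt1 // powR_gt0.
have conv : convexity_const p 1 1 = (2 `^ p - 1)^-1 :> R.
  rewrite /convexity_const /dyadic_const /= !mul1r addr0 mulr1 expr1 half.
  by field; rewrite gt_eqF //= gt_eqF // powR_gt0.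
(* The choice [mu - 1 = t / (A_p C)] makes the perturbation factor exactly [t ^ p]. *)
have tE : 1 * ((mu - 1) `^ p * (convexity_const p 1 1 * C `^ p)) = t `^ p.
  rewrite mul1r conv -A_const_powR // /mu addrAC subrr add0r.
  rewrite -!powRM ?mulr_ge0 ?invr_ge0 ?(ltW t0) ?(ltW C0) ?(ltW A0) //.
  by congr (_ `^ _); rewrite /c; field; rewrite !gt_eqF.
have hbe : 1 * ((mu - 1) `^ p * (convexity_const p 1 1 * C `^ p)) < 1.
  by rewrite tE -subr_gt0.
have hK := narrow_level_estimate p0 (lexx 1) hV hst mu1 hs hbe.
rewrite tE in hK.
have muE : 1 * mu^-1 `^ p = mu `^ (- p) by rewrite mul1r powRV ?(ltW mu0) // powRN.
have hmu : 1 * mu^-1 `^ p < 1 by rewrite muE -subr_gt0.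
have K0 : 0 <= 1 / (1 - t `^ p) by rewrite divr_ge0 // ltW.
have := usum_le_rsum p0 (lexx 1) hV hst K0 (powR_ge0 C p) mu1 hK hmu ha.
set u := usum _ _ _; set w := rsum _ _ _ _ _ => main.
(* The [p]-th root is taken by contradiction, through strict monotonicity of the power [p]. *)
rewrite leNgt; apply/negP => lt_uw.
have N0 := qnorm_ge0 hN.
have v0 := mulr_ge0 v1_ge0 v2_ge0.
have := gt0_ltr_powR p0 _ _ lt_uw.
rewrite !nnegrE => /(_ (mulr_ge0 (mulr_ge0 (ltW C0) v0) (N0 w)) (N0 u)).
rewrite ltNge => /negP; apply; apply: (le_trans main).
rewrite (powRM p (mulr_ge0 (ltW C0) v0) (N0 w)) (powRM p (ltW C0) v0).
rewrite (powRM p v1_ge0 v2_ge0) v1p v2p muE le_eqVlt; apply/orP; left.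
by apply/eqP; field; rewrite !gt_eqF.
Qed.

End Constants.

Theorem theorem3p8 (R : realType) (k : scalar_kind)
    (X : lmodType (scalar_field R k)) (N : X -> R)
    (x : nat -> X) (xs : nat -> {scalar X})
    (hX : quasi_banach N) (hB : quasi_greedy N x xs) :
  lucc N x /\
  (forall p : R, 0 < p <= 1 -> p_banach p N ->
    exists Klc Cqg eta : R,
      [/\ is_Klc N x Klc, is_Cqg N x xs Cqg, is_eta p Cqg eta &
          Klc <= Cqg * eta]).
Proof.
have [hN _] := hX.
have [[_ _ hbi] _ [[c c0 hc] _] hqg] := hB.
have x0 : N (x 0%N) != 0 by rewrite gt_eqF // (lt_le_trans c0).
have [C hC] := qg_constants_nonempty hN hqg.
have hlucc := lucc_of_qg hN x0 hbi hC.
split=> // p /andP[p0 _] [_ hp].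
have [K hK] := hlucc; have [Klc hKlc] := Klc_exists hN hK.
have [Cqg hCqg] := Cqg_exists hN x0 hbi hC.
have Cqg0 : 0 < Cqg.
  by apply: lt_le_trans (qg_constants_ge1 hN hbi x0 hCqg.1).
have [eta heta] := eta_exists p0 Cqg0.
exists Klc, Cqg, eta; split=> //.
(* The minimum [eta] is the value at some [t], which turns [Cqg * eta] into a LUCC constant, hence
   an upper bound for the least one. *)
have [[t ht <-] _] := heta.
by apply: hKlc.2; exact: lucc_constants_of_qg hCqg.1 p0 hp ht.
Qed.
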